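(* Let $G$ be a countable discrete abelian group and let $(X,\mathcal B,\mu,(T_g)_{g\in G})$ be a measure-preserving $G$-system (not necessarily ergodic). Let $A\in\mathcal B$, $k\in\mathbb N$ and $\varepsilon>0$. There is a syndetic set $S\subseteq\mathrm{Hom}(G,G)^k$ such that for every $(\varphi_1,\dots,\varphi_k)\in S$ the set $$R_\varepsilon(\varphi_1,\dots,\varphi_k):=\Big\{g\in G:\mu\Big(\bigcap_{\omega\in\{0,1\}^k}T^{-1}_{(\omega_1\varphi_1+\cdots+\omega_k\varphi_k)(g)}A\Big)>\mu(A)^{2^k}-\varepsilon\Big\}$$ is syndetic in $G$.
   Context: $\mathrm{Hom}(G,G)$ is the abelian group of homomorphisms $G\to G$ under pointwise addition, with the topology of pointwise convergence ($\varphi_n\to\varphi$ iff for each $g$, $\varphi_n(g)=\varphi(g)$ eventually); it is a locally compact abelian group, and $\mathrm{Hom}(G,G)^k$ carries the product topology. A subset $S$ of a locally compact abelian group $\Gamma$ is syndetic if there is a compact $K\subseteq\Gamma$ with $S+K=\Gamma$; for discrete $G$ this means finitely many translates of $S$ cover $G$. *)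

(* Defs.v *)
From HB Require Import structures.
From mathcomp Require Import all_boot all_order all_algebra.
From mathcomp Require Import all_classical all_reals all_analysis.
Set Implicit Arguments. Unset Strict Implicit. Unset Printing Implicit Defensive.
Import Order.TTheory GRing.Theory Num.Theory.
Local Open Scope classical_set_scope.
Local Open Scope ring_scope.

Definition hom_set (G : zmodType) : set (G -> G) :=
  [set f | forall x y : G, f (x + y) = f x + f y].

Definition homk_set (G : zmodType) (k : nat) : set ('I_k -> G -> G) :=
  [set phi | forall i, hom_set (phi i)].

Definition homk_top (G : countZmodType) (k : nat) : Type :=
  {ptws 'I_k -> {ptws G -> discrete_topology G}}.

Definition syndetic_homk (G : countZmodType) (k : nat)
  (S : set ('I_k -> G -> G)) : Prop :=
  S `<=` @homk_set G k /\
  exists K : set (homk_top G k),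
    compact K /\ K `<=` @homk_set G k /\
    forall psi, @homk_set G k psi ->
      exists2 s, S s & exists2 c, K c & psi = (fun i g => s i g + c i g).

Definition syndetic_discrete (G : zmodType) (R : set G) : Prop :=
  exists F : seq G, forall g : G, exists2 f, f \in F & R (g - f).

Definition mp_action (G : zmodType) d (X : measurableType d) (R : realType)
  (mu : probability X R) (T : G -> X -> X) : Prop :=
  [/\ T 0 = id,
      forall g h, T (g + h) = T g \o T h,
      forall g, measurable_fun setT (T g) &
      forall g (A : set X), measurable A -> mu (T g @^-1` A) = mu A].

Definition Rset (G : zmodType) d (X : measurableType d) (R : realType)
  (mu : probability X R) (T : G -> X -> X) (A : set X) (k : nat)
  (eps : R) (phi : 'I_k -> G -> G) : set G :=
  [set g | fine (mu (\bigcap_(w in [set: 'I_k -> bool])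
              (T (\sum_(i < k) (phi i g *+ w i)) @^-1` A)))
           > fine (mu A) ^+ (2 ^ k) - eps].

(* Main.v *)
(* For phi in Hom(G,G)^k let f(phi, g) be the measure of the intersection in
   the statement. The averages over g of a multiple correlation of commuting
   actions do not depend on the invariant mean m on G: the averaged vectors
   D_m satisfy <D_n, D_m> = m_g n_h <d_(h+g), d_g>, a correlation with one
   factor fewer, so ||D_m - D_m'||^2 = 0 by induction. Hence
   a(phi) := m_g f(phi, g) is well defined, and whenever a(phi) > c, every
   invariant mean of f(phi, .) exceeds c and {g : f(phi, g) > c} is syndetic by
   Hahn-Banach.

   On the product of (G, m) and X, Hom(G,G) acts by (g, x) |-> (g, T_(psi g) x),
   and a(phi) is the cube correlation of this action at phi. Its mean over
   Hom(G,G)^k is again independent of the mean, so it may be computed one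
   coordinate at a time, where Khintchine's inequality gives the lower bound
   mu(A)^(2^k). Thus S = {phi : a(phi) > mu(A)^(2^k) - eps} is syndetic, even
   with a finite K. *)
Require Import Defs.
From HB Require Import structures.
From mathcomp Require Import all_boot all_order all_algebra.
From mathcomp Require Import all_classical all_reals all_analysis.
From mathcomp Require Import ring lra.
Set Implicit Arguments. Unset Strict Implicit. Unset Printing Implicit Defensive.
Import Order.TTheory GRing.Theory Num.Theory.
Local Open Scope classical_set_scope.
Local Open Scope ring_scope.

(** * States *)

Definition bfun (R : realType) (Y : Type) : set (Y -> R) :=
  [set f | exists C, forall y, `|f y| <= C].

(* Expectations are only finitely additive, so that invariant means on bounded
   functions, and their products with integrals, are states. *)
Record is_state (R : realType) (Y : Type) (A : set (Y -> R))
    (E : (Y -> R) -> R) : Prop := IsState {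
  state_bfun : A `<=` @bfun R Y;
  state_cst : forall c, A (fun=> c);
  stateD : forall f g, A f -> A g -> A (fun y => f y + g y);
  stateM : forall f g, A f -> A g -> A (fun y => f y * g y);
  expectD : forall f g, A f -> A g -> E (fun y => f y + g y) = E f + E g;
  expectZ : forall c f, A f -> E (fun y => c * f y) = c * E f;
  expect_ge0 : forall f, A f -> (forall y, 0 <= f y) -> 0 <= E f;
  expect1 : E (fun=> 1) = 1 }.

Section StateTheory.
Context (R : realType) (Y : Type) (A : set (Y -> R)) (E : (Y -> R) -> R).
Hypothesis st : is_state A E.
Implicit Types f g u v w : Y -> R.

Lemma stateZ c f : A f -> A (fun y => c * f y).
Proof. by move=> Af; exact: (stateM st (state_cst st c) Af). Qed.

Lemma state_prod (I : Type) (s : seq I) (F : I -> Y -> R) :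
  (forall i, A (F i)) -> A (fun y => \prod_(i <- s) F i y).
Proof.
move=> AF; elim: s => [|i s IH].
  rewrite [X in A X](_ : _ = fun=> 1); first exact: (state_cst st).
  by apply/funext => y; rewrite big_nil.
rewrite [X in A X](_ : _ = fun y => F i y * \prod_(i <- s) F i y).
  exact: (stateM st).
by apply/funext => y; rewrite big_cons.
Qed.

Lemma expect_cst c : E (fun=> c) = c.
Proof.
rewrite (_ : (fun=> c) = fun y : Y => c * 1); last first.
  by apply/funext => y; rewrite mulr1.
by rewrite (expectZ st) ?(expect1 st) ?mulr1//; exact: (state_cst st).
Qed.

Lemma expectB f g : A f -> A g -> E (fun y => f y - g y) = E f - E g.
Proof.
move=> Af Ag; rewrite (_ : (fun y => _) = fun y => f y + -1 * g y); last first.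
  by apply/funext => y; rewrite mulN1r.
rewrite (expectD st Af (stateZ (-1) Ag)) (expectZ st) //; lra.
Qed.

Lemma le_expect f g : A f -> A g -> (forall y, f y <= g y) -> E f <= E g.
Proof.
move=> Af Ag fg; rewrite -subr_ge0 -expectB//; apply: (expect_ge0 st).
  rewrite [X in A X](_ : _ = fun y => g y + -1 * f y).
    by apply: (stateD st) => //; exact: stateZ.
  by apply/funext => y; rewrite mulN1r.
by move=> y; rewrite subr_ge0.
Qed.

Lemma le_expect_cst f c : A f -> (forall y, f y <= c) -> E f <= c.
Proof.
by move=> Af fc; rewrite -(expect_cst c); apply: le_expect => //; exact: (state_cst st).
Qed.

Lemma ge_expect_cst f c : A f -> (forall y, c <= f y) -> c <= E f.
Proof.
by move=> Af fc; rewrite -(expect_cst c); apply: le_expect => //; exact: (state_cst st).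
Qed.

Lemma norm_expect_le f c : A f -> (forall y, `|f y| <= c) -> `|E f| <= c.
Proof.
move=> Af fc; rewrite ler_norml; apply/andP; split.
  by apply: ge_expect_cst => // y; move: (fc y); rewrite ler_norml => /andP[].
by apply: le_expect_cst => // y; move: (fc y); rewrite ler_norml => /andP[].
Qed.

Lemma expect_sqr_ge0 f : A f -> 0 <= E (fun y => f y * f y).
Proof.
by move=> Af; apply: (expect_ge0 st); [exact: (stateM st)|move=> y; rewrite -expr2 sqr_ge0].
Qed.

Lemma expect_sqrD f g : A f -> A g ->
  E (fun y => (f y + g y) * (f y + g y)) =
  E (fun y => f y * f y) + 2 * E (fun y => f y * g y) + E (fun y => g y * g y).
Proof.
move=> Af Ag.
rewrite (_ : (fun y => _) = fun y => (f y * f y + 2 * (f y * g y)) + g y * g y);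
  last by apply/funext => y; ring.
have Aff := stateM st Af Af; have Agg := stateM st Ag Ag.
have Afg := stateM st Af Ag; have A2fg := stateZ 2 Afg.
by rewrite (expectD st (stateD st Aff A2fg) Agg) (expectD st Aff A2fg) (expectZ st).
Qed.

Lemma expect_sqrZ c f : A f ->
  E (fun y => (c * f y) * (c * f y)) = c ^+ 2 * E (fun y => f y * f y).
Proof.
move=> Af; rewrite -(expectZ st); last exact: (stateM st).
by congr (E _); apply/funext => y; ring.
Qed.

Lemma expectMZr c f g : A f -> A g ->
  E (fun y => f y * (c * g y)) = c * E (fun y => f y * g y).
Proof.
move=> Af Ag; rewrite -(expectZ st); last exact: (stateM st).
by congr (E _); apply/funext => y; ring.
Qed.

(** Expand [E ((s f + e g)^2) >= 0] for [e = 1] and [e = -1], then divide by [s]. This form of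
    Cauchy-Schwarz avoids square roots, and the free weight [s] lets a quadratic term absorb a
    linear one. *)
Lemma expectM_AGM s f g : 0 < s -> A f -> A g ->
  2 * `|E (fun y => f y * g y)| <=
  s * E (fun y => f y * f y) + s^-1 * E (fun y => g y * g y).
Proof.
move=> s0 Af Ag.
have sV : s * s^-1 = 1 by rewrite mulfV// gt_eqF.
have key (e : R) : e ^+ 2 = 1 ->
    0 <= s * (s * E (fun y => f y * f y) + s^-1 * E (fun y => g y * g y)
      + 2 * e * E (fun y => f y * g y)).
  move=> e1.
  have AS := stateZ s Af; have AG := stateZ e Ag.
  have := expect_sqr_ge0 (stateD st AS AG).
  rewrite (expect_sqrD AS AG) !expect_sqrZ// expectMZr//.
  have -> : E (fun y => s * f y * g y) = s * E (fun y => f y * g y).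
    rewrite -(expectZ st); last exact: (stateM st).
    by congr (E _); apply/funext => y; ring.
  rewrite e1 mulrDr mulrDr [s * (s^-1 * _)]mulrA sV; lra.
have /pmulr_rge0 s0' := s0.
have := key 1 (expr1n _ _); have := key (-1) (sqrr_sign _ 1).
rewrite !s0' => k1 k2.
rewrite -[2 in X in X <= _](gtr0_norm (ltr0n _ 2)) -normrM ler_norml; lra.
Qed.

(* This replaces the Riesz representation theorem in the (incomplete) space
   [A]: an almost-minimiser of [E u^2 - 2 l u] represents [l] up to a small
   error on bounded sets. *)
Lemma riesz_approx (l : (Y -> R) -> R) (K : R) :
  (forall f g, A f -> A g -> l (fun y => f y + g y) = l f + l g) ->
  (forall c f, A f -> l (fun y => c * f y) = c * l f) ->
  (forall f, A f -> 2 * l f <= 2^-1 * E (fun y => f y * f y) + K) ->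
  forall B d : R, 0 < d -> exists v, [/\ A v,
    E (fun y => v y * v y) <= 2 + 2 * K,
    (forall w, A w -> E (fun y => w y * w y) <= B ->
       `|l w - E (fun y => w y * v y)| <= d) &
    (forall u, A u -> E (fun y => v y * v y) - 2 * l v <=
       E (fun y => u y * u y) - 2 * l u + d)].
Proof.
move=> lD lZ lK B d d0.
pose B1 := `|B| + 1; have B10 : 0 < B1 by rewrite ltr_wpDl.
have BB1 : B <= B1 by rewrite (le_trans (ler_norm _))// lerDl.
pose s := d / B1; have s0 : 0 < s by rewrite divr_gt0.
have sB1 : s * B1 = d by rewrite mulfVK// gt_eqF.
(* Each term of the minimum serves one clause: [1] bounds the norm of [v], [d] gives
   almost-minimality, and [s * d] controls the variation of [Q] at [v] along [s * w] and
   [- s * w]. *)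
pose eta := Num.min 1 (Num.min d (s * d)).
have eta0 : 0 < eta by rewrite !lt_min ltr01 d0 mulr_gt0.
have eta1 : eta <= 1 by rewrite ge_min lexx.
have etad : eta <= d by rewrite !ge_min lexx orbT.
have etasd : eta <= s * d by rewrite !ge_min lexx !orbT.
pose Q u := E (fun y => u y * u y) - 2 * l u.
pose S := [set Q u | u in A].
have A0 : A (fun=> 0) by exact: (state_cst st).
have Sinf : has_inf S.
  split; first by exists (Q (fun=> 0)), (fun=> 0).
  exists (- K) => _ [u Au <-].
  have := lK _ Au; have := expect_sqr_ge0 Au; rewrite /Q; lra.
have [_ [v Av <-] Qv] := inf_adherent eta0 Sinf.
have Qmin u : A u -> Q v <= Q u + eta.
  move=> Au; have : inf S <= Q u by apply: ge_inf; [exact: Sinf.2|exists u].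
  by move: Qv; rewrite -/S; lra.
exists v; split => //.
- have := Qmin _ A0; have -> : Q (fun=> 0) = 0.
    rewrite /Q; have -> : l (fun=> 0) = 0.
      by have := lZ 0 _ A0; rewrite !mul0r.
    by rewrite !mulr0 expect_cst subr0.
  have := lK _ Av; have := expect_sqr_ge0 Av; rewrite /Q; lra.
- move=> w Aw wB.
  have key t : 0 <= 2 * t * (E (fun y => w y * v y) - l w)
      + t ^+ 2 * E (fun y => w y * w y) + eta.
    have Atw := stateZ t Aw; have := Qmin _ (stateD st Av Atw).
    rewrite /Q (expect_sqrD Av Atw) (lD _ _ Av Atw) lZ// expect_sqrZ// expectMZr//.
    have -> : E (fun y => v y * w y) = E (fun y => w y * v y).
      by congr (E _); apply/funext => y; rewrite mulrC.
    lra.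
  have := key s; have := key (- s); rewrite sqrrN.
  have sw : s ^+ 2 * E (fun y => w y * w y) <= s * d.
    rewrite expr2 -mulrA ler_pM2l// -sB1 ler_pM2l//; exact: le_trans BB1.
  set x := _ - l w => k1 k2.
  rewrite distrC -/x ler_norml -(ler_pM2l s0) -[X in _ && X](ler_pM2l s0); lra.
- by move=> u /Qmin; rewrite /Q; lra.
Qed.

End StateTheory.

(** * Means of bounded families of vectors *)

Section MeansOfVectors.
Context (R : realType) (Y : Type) (A : set (Y -> R)) (E : (Y -> R) -> R).
Hypothesis st : is_state A E.
Context (G : Type) (e : G -> Y -> R) (C : R).
Hypotheses (Ae : forall g, A (e g))
  (eC : forall g, E (fun y => e g y * e g y) <= C).

Lemma expectM_bfun w : A w -> bfun (fun g => E (fun y => w y * e g y)).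
Proof.
move=> Aw; exists (E (fun y => w y * w y) + C) => g.
have := expectM_AGM st ltr01 Aw (Ae g); rewrite invr1 !mul1r.
have := normr_ge0 (E (fun y => w y * e g y)); have := eC g; lra.
Qed.

Context (m : (G -> R) -> R).
Hypothesis sm : is_state (@bfun R G) m.

Lemma mean_expectD f g : A f -> A g ->
  m (fun x => E (fun y => (f y + g y) * e x y)) =
  m (fun x => E (fun y => f y * e x y)) + m (fun x => E (fun y => g y * e x y)).
Proof.
move=> Af Ag; rewrite -(expectD sm); try exact: expectM_bfun.
congr m; apply/funext => x.
rewrite -(expectD st); try exact: (stateM st).
by congr E; apply/funext => y; ring.
Qed.

Lemma mean_expectZ c f : A f ->
  m (fun x => E (fun y => (c * f y) * e x y)) =
  c * m (fun x => E (fun y => f y * e x y)).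
Proof.
move=> Af; rewrite -(expectZ sm); try exact: expectM_bfun.
congr m; apply/funext => x.
rewrite -(expectZ st); try exact: (stateM st).
by congr E; apply/funext => y; ring.
Qed.

(** Applied with small [s], this yields the quadratic bound that [riesz_approx] requires of the
    functional pairing a vector with the mean of [e]. *)
Lemma mean_expect_AGM s f : 0 < s -> A f ->
  2 * `|m (fun x => E (fun y => f y * e x y))| <=
  s * E (fun y => f y * f y) + s^-1 * C.
Proof.
move=> s0 Af; rewrite mulrC -ler_pdivlMr//; apply: (norm_expect_le sm).
  exact: expectM_bfun.
move=> x; rewrite ler_pdivlMr// mulrC.
apply: (le_trans (expectM_AGM st s0 Af (Ae x))).
by rewrite lerD2l ler_wpM2l// invr_ge0 ltW.
Qed.

End MeansOfVectors.

Lemma dist_mean_le (R : realType) (G : Type) (m : (G -> R) -> R) (f g : G -> R)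
    (d : R) : is_state (@bfun R G) m -> bfun f -> bfun g ->
  (forall x, `|f x - g x| <= d) -> `|m f - m g| <= d.
Proof.
move=> sm bf bg fg; rewrite -(expectB sm)//; apply: (norm_expect_le sm) => //.
by exists d.
Qed.

Lemma norm_le_arbitrarily_small (R : realType) (x : R) (c : R) :
  (forall d, 0 < d -> `|x| <= c * d) -> x = 0.
Proof.
move=> H; apply/eqP; rewrite -normr_le0; apply/ler_addgt0Pl => d d0.
have c1 : 0 < `|c| + 1 by rewrite ltr_wpDl.
have := H _ (divr_gt0 d0 c1) => /le_trans; apply.
rewrite addr0 mulrA ler_pdivrMr// mulrC ler_pM2l//.
by rewrite (le_trans (ler_norm _))// lerDl.
Qed.

(** Finitely additive means need not commute on a bounded kernel; here the kernel is an inner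
    product. If [v] nearly represents the mean of [e] and [u] that of [d], both sides are close to
    [E (u v)]. *)
Lemma mean_exchange (R : realType) (Y : Type) (A : set (Y -> R))
    (E : (Y -> R) -> R) (H G : Type) (n : (H -> R) -> R) (m : (G -> R) -> R)
    (d : H -> Y -> R) (e : G -> Y -> R) (C : R) :
  is_state A E -> is_state (@bfun R H) n -> is_state (@bfun R G) m ->
  (forall h, A (d h)) -> (forall g, A (e g)) ->
  (forall h, E (fun y => d h y * d h y) <= C) ->
  (forall g, E (fun y => e g y * e g y) <= C) ->
  n (fun h => m (fun g => E (fun y => d h y * e g y))) =
  m (fun g => n (fun h => E (fun y => d h y * e g y))).
Proof.
move=> st sn sm Ad Ae dC eC.
pose l w := m (fun g => E (fun y => w y * e g y)).
pose l' w := n (fun h => E (fun y => w y * d h y)).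
have comm u v : E (fun y => u y * v y) = E (fun y => v y * u y).
  by congr E; apply/funext => y; rewrite mulrC.
have bl : bfun (fun h => l (d h)).
  exists (C + C) => h.
  have := mean_expect_AGM st Ae eC sm ltr01 (Ad h).
  rewrite invr1 !mul1r -/(l _).
  have := normr_ge0 (l (d h)); have := dC h; lra.
have bl' : bfun (fun g => l' (e g)).
  exists (C + C) => g.
  have := mean_expect_AGM st Ad dC sn ltr01 (Ae g).
  rewrite invr1 !mul1r -/(l' _).
  have := normr_ge0 (l' (e g)); have := eC g; lra.
have half w : A w -> 2 * l w <= 2^-1 * E (fun y => w y * w y) + 2 * C.
  move=> Aw; have h0 : (0 : R) < 2^-1 by rewrite invr_gt0.
  have := mean_expect_AGM st Ae eC sm h0 Aw; rewrite invrK -/(l w).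
  have := ler_norm (l w); lra.
have half' w : A w -> 2 * l' w <= 2^-1 * E (fun y => w y * w y) + 2 * C.
  move=> Aw; have h0 : (0 : R) < 2^-1 by rewrite invr_gt0.
  have := mean_expect_AGM st Ad dC sn h0 Aw; rewrite invrK -/(l' w).
  have := ler_norm (l' w); lra.
apply/eqP; rewrite -subr_eq0; apply/eqP.
(* One error [t] for each link of the chain [n (l d)], [l' v], [E (u v)], [l u], [m (l' e)]. *)
apply: (@norm_le_arbitrarily_small _ _ 4) => t t0.
(* [B] dominates [C], so that [d h] and [e g] are admissible test vectors, and also the squared
   norms of [u] and [v], so that these can be tested against each other. *)
pose B := 2 + 2 * (2 * C) + `|C|.
have CB : C <= B.
  have := half _ (state_cst st 0); rewrite /B; have := ler_norm C.
  have -> : l (fun=> 0) = 0.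
    rewrite /l -[RHS](expect_cst sm); congr m; apply/funext => g.
    by rewrite -[RHS](expect_cst st); congr E; apply/funext => y; rewrite mul0r.
  have -> : E (fun y => (fun=> 0) y * (fun=> 0) y) = 0 by rewrite mulr0 (expect_cst st).
  lra.
have nC := normr_ge0 C.
have [v [Av vB v_approx _]] := riesz_approx st
  (mean_expectD st Ae eC sm) (mean_expectZ st Ae eC sm) half B t0.
have [u [Au uB u_approx _]] := riesz_approx st
  (mean_expectD st Ad dC sn) (mean_expectZ st Ad dC sn) half' B t0.
have vB' : E (fun y => v y * v y) <= B by rewrite /B; lra.
have uB' : E (fun y => u y * u y) <= B by rewrite /B; lra.
have bdv : bfun (fun h => E (fun y => d h y * v y)).
  have [c cP] := expectM_bfun st Ad dC Av; exists c => h.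
  by rewrite comm.
have := expectM_bfun st Ae eC Au => beu.
have bld h := v_approx _ (Ad h) (le_trans (dC h) CB).
have ble g := u_approx _ (Ae g) (le_trans (eC g) CB).
have beu' : bfun (fun g => E (fun y => e g y * u y)).
  by have [c cP] := beu; exists c => g; rewrite comm.
have h1 := dist_mean_le sn bl bdv bld.
have h2 := dist_mean_le sm bl' beu' ble.
have h3 := v_approx _ Au uB'; have h4 := u_approx _ Av vB'.
have e1 : n (fun h => E (fun y => d h y * v y)) = l' v.
  by congr n; apply/funext => h; rewrite comm.
have e2 : m (fun g => E (fun y => e g y * u y)) = l u.
  by congr m; apply/funext => g; rewrite comm.
have e3 : m (fun g => l' (e g)) = m (fun g => n (fun h => E (fun y => d h y * e g y))).
  by congr m; apply/funext => g; congr n; apply/funext => h; rewrite comm.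
rewrite -e3; rewrite e1 in h1; rewrite e2 in h2.
rewrite -/(l u) in h3; rewrite -/(l' v) in h4; rewrite (comm v u) in h4.
move: h1 h2 h3 h4; rewrite /l !ler_norml; rewrite -/(l u).
lra.
Qed.

(** The hypothesis makes the difference [D] of the two mean vectors orthogonal to each of them, so
    [<D, D> = 0]. As [D] need not exist in [A], an approximate minimiser stands in for it. *)
Lemma mean_eq_of_orthogonal (R : realType) (Y : Type) (A : set (Y -> R))
    (E : (Y -> R) -> R) (G : Type) (m m' : (G -> R) -> R) (d : G -> Y -> R) (C : R) :
  is_state A E -> is_state (@bfun R G) m -> is_state (@bfun R G) m' ->
  (forall g, A (d g)) -> (forall g, E (fun y => d g y * d g y) <= C) ->
  (forall n, n = m \/ n = m' ->
    n (fun h => m (fun g => E (fun y => d h y * d g y))) =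
    n (fun h => m' (fun g => E (fun y => d h y * d g y)))) ->
  forall v, A v -> m (fun g => E (fun y => v y * d g y)) =
                   m' (fun g => E (fun y => v y * d g y)).
Proof.
move=> st sm sm' Ad dC orth v Av.
pose l0 w := m (fun g => E (fun y => w y * d g y)).
pose l1 w := m' (fun g => E (fun y => w y * d g y)).
pose l w := l0 w - l1 w.
have l0D := mean_expectD st Ad dC sm; have l1D := mean_expectD st Ad dC sm'.
have l0Z := mean_expectZ st Ad dC sm; have l1Z := mean_expectZ st Ad dC sm'.
have lD f g : A f -> A g -> l (fun y => f y + g y) = l f + l g.
  by move=> Af Ag; rewrite /l /l0 /l1 l0D// l1D//; ring.
have lZ c f : A f -> l (fun y => c * f y) = c * l f.
  by move=> Af; rewrite /l /l0 /l1 l0Z// l1Z//; ring.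
have lK w : A w -> 2 * l w <= 2^-1 * E (fun y => w y * w y) + 8 * C.
  move=> Aw; have h0 : (0 : R) < 4^-1 by rewrite invr_gt0.
  have := mean_expect_AGM st Ad dC sm h0 Aw.
  have := mean_expect_AGM st Ad dC sm' h0 Aw; rewrite invrK -/(l0 w) -/(l1 w).
  have := ler_norm (l0 w); have := ler_norm (- l1 w); rewrite normrN /l; lra.
have bl0 : bfun (fun h => l0 (d h)).
  exists (C + C) => h; have := mean_expect_AGM st Ad dC sm ltr01 (Ad h).
  rewrite invr1 !mul1r -/(l0 _).
  have := normr_ge0 (l0 (d h)); have := dC h; lra.
have bl1 : bfun (fun h => l1 (d h)).
  exists (C + C) => h; have := mean_expect_AGM st Ad dC sm' ltr01 (Ad h).
  rewrite invr1 !mul1r -/(l1 _).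
  have := normr_ge0 (l1 (d h)); have := dC h; lra.
have bl : bfun (fun h => l (d h)).
  have [c0 c0P] := bl0; have [c1 c1P] := bl1; exists (c0 + c1) => h.
  by rewrite (le_trans (ler_normB _ _))// lerD.
(* The infimum of this quadratic expression is formally minus the squared norm of [l], so its
   nonnegativity forces [l = 0]. *)
have Qge0 u : A u -> 0 <= E (fun y => u y * u y) - 2 * l u.
  move=> Au; apply/ler_addgt0Pl => d0 d0_gt0.
  (* [l w] is a difference of two terms of size at most [d0 / 5] and enters doubled;
     almost-minimality costs the fifth share. *)
  have t0 : 0 < d0 / 5 by rewrite divr_gt0.
  have [w [Aw _ w_approx wmin]] := riesz_approx st lD lZ lK C t0.
  have bw : bfun (fun h => E (fun y => d h y * w y)).
    have [c cP] := expectM_bfun st Ad dC Aw; exists c => h.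
    by rewrite [X in `|X|](_ : _ = E (fun y => w y * d h y))//;
      congr E; apply/funext => y; rewrite mulrC.
  have lw n : is_state (@bfun R G) n -> n = m \/ n = m' ->
      `|n (fun h => E (fun y => w y * d h y))| <= d0 / 5.
    move=> sn nE.
    have := dist_mean_le sn bl bw (fun h => w_approx _ (Ad h) (dC h)).
    have -> : n (fun h => l (d h)) = 0.
      rewrite (expectB sn bl0 bl1); apply/eqP; rewrite subr_eq0; apply/eqP.
      exact: orth.
    rewrite sub0r normrN; congr (`|n _| <= _); apply/funext => h.
    by congr E; apply/funext => y; rewrite mulrC.
  have := lw _ sm (or_introl erefl); have := lw _ sm' (or_intror erefl).
  have := wmin _ Au; have := expect_sqr_ge0 st Aw.
  rewrite -/(l0 w) -/(l1 w) !ler_norml.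
  rewrite [l w]/l; lra.
have a0 := expect_sqr_ge0 st Av; set a := E _ in a0.
have a1 : 0 < a + 1 by lra.
(* The best multiple of [v] would be [l v / a]; the added [1] avoids a division by zero and still
   gives a negative value unless [l v = 0]. *)
have := Qge0 _ (stateZ st (l v / (a + 1)) Av).
rewrite (expect_sqrZ st)// lZ// -/a => q.
have : 0 <= - (l v) ^+ 2 * (a + 2).
  have -> : - (l v) ^+ 2 * (a + 2) = ((l v / (a + 1)) ^+ 2 * a - 2 * (l v / (a + 1) * l v)) * (a + 1) ^+ 2.
    by field; rewrite gt_eqF.
  by rewrite mulr_ge0// sqr_ge0.
rewrite pmulr_lge0; last lra.
rewrite oppr_ge0 => lv0.
have : l v ^+ 2 == 0 by rewrite eq_le lv0 sqr_ge0.
by rewrite sqrf_eq0 /l subr_eq0 => /eqP.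
Qed.

(** * Correlations of commuting actions *)

Definition inv_mean (R : realType) (G : zmodType) (m : (G -> R) -> R) : Prop :=
  is_state (@bfun R G) m /\
  forall f h, bfun f -> m (fun g => f (g + h)) = m f.

Record is_action (R : realType) (G : zmodType) (I Y : Type) (A : set (Y -> R))
    (E : (Y -> R) -> R) (V : I -> G -> Y -> Y) : Prop := IsAction {
  act0 : forall i y, V i 0 y = y;
  actD : forall i g h y, V i (g + h) y = V i g (V i h y);
  actC : forall i j g h y, V i g (V j h y) = V j h (V i g y);
  act_state : forall i g f, A f -> A (fun y => f (V i g y));
  act_expect : forall i g f, A f -> E (fun y => f (V i g y)) = E f }.

(** Only boundedness is asked in the direction of [H]: [n] is defined on every bounded function, so
    no joint measurability is involved. *)
Definition fibre_fun (R : realType) (H Y : Type) (A : set (Y -> R)) : set (H * Y -> R) :=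
  [set F | bfun F /\ forall h, A (fun y => F (h, y))].

Definition fibre_expect (R : realType) (H Y : Type) (n : (H -> R) -> R)
    (E : (Y -> R) -> R) (F : H * Y -> R) : R :=
  n (fun h => E (fun y => F (h, y))).

Section Fibre.
Context (R : realType) (H Y : Type) (A : set (Y -> R)) (E : (Y -> R) -> R)
  (n : (H -> R) -> R).
Hypotheses (st : is_state A E) (sn : is_state (@bfun R H) n).

Lemma fibre_expect_bfun F : fibre_fun A F -> bfun (fun h : H => E (fun y => F (h, y))).
Proof.
move=> [[C FC] AF]; exists C => h; exact: (norm_expect_le st).
Qed.

Lemma bfunD (Z : Type) (f g : Z -> R) : bfun f -> bfun g -> bfun (fun z => f z + g z).
Proof.
move=> [c fc] [c' gc']; exists (c + c') => z.
by rewrite (le_trans (ler_normD _ _))// lerD.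
Qed.

Lemma bfunM (Z : Type) (f g : Z -> R) : bfun f -> bfun g -> bfun (fun z => f z * g z).
Proof.
by move=> [c fc] [c' gc']; exists (c * c') => z; rewrite normrM ler_pM.
Qed.

Lemma fibre_state : is_state (@fibre_fun R H Y A) (fibre_expect n E).
Proof.
split.
- by move=> F [].
- by move=> c; split; [by exists (`|c|)|move=> h; exact: (state_cst st)].
- move=> F F' [bF AF] [bF' AF']; split; first exact: bfunD.
  by move=> h; exact: (stateD st).
- move=> F F' [bF AF] [bF' AF']; split; first exact: bfunM.
  by move=> h; exact: (stateM st).
- move=> F F' AF AF'; rewrite /fibre_expect -(expectD sn); try exact: fibre_expect_bfun.
  by congr n; apply/funext => h; rewrite -(expectD st)//; [exact: AF.2|exact: AF'.2].
- move=> c F AF; rewrite /fibre_expect -(expectZ sn); try exact: fibre_expect_bfun.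
  by congr n; apply/funext => h; rewrite -(expectZ st)//; exact: AF.2.
- move=> F AF F0; apply: (expect_ge0 sn); first exact: fibre_expect_bfun.
  by move=> h; apply: (expect_ge0 st) => //; exact: AF.2.
- rewrite /fibre_expect -[RHS](expect1 sn); congr n; apply/funext => h.
  exact: (expect1 st).
Qed.

(** The action may vary with the point [h]. A constant family serves the induction on the number of
    factors; a varying one gives the action of [Hom(G,G)^k] on [G * X]. *)
Lemma fibre_action (G : zmodType) (I : Type) (V : H -> I -> G -> Y -> Y) :
  (forall h, is_action A E (V h)) ->
  is_action (@fibre_fun R H Y A) (fibre_expect n E) (fun i g z => (z.1, V z.1 i g z.2)).
Proof.
move=> aV; split.
- by move=> i [h y] /=; rewrite (act0 (aV h)).
- by move=> i g g' [h y] /=; rewrite (actD (aV h)).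
- by move=> i j g g' [h y] /=; rewrite (actC (aV h)).
- move=> i g F [[C FC] AF]; split; first by exists C.
  by move=> h /=; exact: (act_state (aV h) i g (AF h)).
- move=> i g F [_ AF]; congr n; apply/funext => h /=.
  exact: (act_expect (aV h) i g (AF h)).
Qed.

End Fibre.

Section Correlations.
Context (R : realType) (G : zmodType) (I : Type).

Lemma prod_bounded (Z : Type) (s : seq I) (F : I -> Z -> R) :
  (forall i, bfun (F i)) -> exists C, forall z : I -> Z,
    `|\prod_(i <- s) F i (z i)| <= C.
Proof.
move=> bF; elim: s => [|i s [C IH]].
  by exists 1 => z; rewrite big_nil normr1.
have [c cP] := bF i; exists (c * C) => z.
by rewrite big_cons normrM ler_pM.
Qed.

(* With [d g] the product pulled back by the last action, the mean over [h] of
   [E (d (h + g) * d g)] is a correlation with one factor fewer on the space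
   [G * Y], whose expectation is the mean over [h] of [E]: this is what makes
   the induction hypothesis uniform in [h]. *)
Lemma correlation_mean_unique (s : seq I) (Y : Type) (A : set (Y -> R))
    (E : (Y -> R) -> R) (V : I -> G -> Y -> Y) (f0 : Y -> R) (f : I -> Y -> R)
    (m m' : (G -> R) -> R) :
  is_state A E -> is_action A E V -> A f0 -> (forall i, A (f i)) ->
  inv_mean m -> inv_mean m' ->
  m (fun g => E (fun y => f0 y * \prod_(i <- s) f i (V i g y))) =
  m' (fun g => E (fun y => f0 y * \prod_(i <- s) f i (V i g y))).
Proof.
elim: s Y A E V f0 f m m' => [|j s IH] Y A E V f0 f m m' st aV Af0 Af [sm im] [sm' im'].
  have -> : (fun g => E (fun y => f0 y * \prod_(i <- [::]) f i (V i g y))) =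
      fun g : G => E f0.
    apply/funext => g; congr E; apply/funext => y; by rewrite big_nil mulr1.
  by rewrite (expect_cst sm) (expect_cst sm').
have actK g y : V j g (V j (- g) y) = y by rewrite -(actD aV) subrr (act0 aV).
have actKV g y : V j (- g) (V j g y) = y by rewrite -(actD aV) addNr (act0 aV).
pose d g y := f0 (V j (- g) y) * \prod_(i <- s) f i (V i g (V j (- g) y)).
have Ad g : A (d g).
  apply: (stateM st); first exact: (act_state aV).
  apply: (state_prod st s) => i.
  exact: (act_state aV j (- g) (act_state aV i g (Af i))).
have [C dC] : exists C, forall g, E (fun y => d g y * d g y) <= C.
  have [c0 c0P] := state_bfun st Af0.
  have [c cP] := prod_bounded s (fun i => state_bfun st (Af i)).
  exists ((c0 * c) * (c0 * c)) => g.
  have dc y : `|d g y| <= c0 * c by rewrite normrM ler_pM.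
  apply: (le_expect_cst st); first exact: (stateM st).
  by move=> y; rewrite (le_trans (ler_norm _))// normrM ler_pM.
have dE g : E (fun y => f0 y * \prod_(i <- j :: s) f i (V i g y)) =
    E (fun y => f j y * d g y).
  rewrite -(act_expect aV j (- g)); last first.
    apply: (stateM st) => //; apply: (state_prod st) => i.
    exact: (act_state aV).
  congr E; apply/funext => y; rewrite big_cons actK /d; ring.
rewrite (funext dE).
apply: (mean_eq_of_orthogonal st sm sm' Ad dC _ (Af j)).
move=> n0 n0E; have [n0s n0i] : inv_mean n0 by case: n0E => ->.
pose F0 (z : G * Y) := f0 z.2 * f0 (V j (- z.1) z.2).
pose F i (z : G * Y) := f i z.2 * f i (V i z.1 (V j (- z.1) z.2)).
pose W i g (z : G * Y) := (z.1, V i g z.2).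
(* Once the mean over [g] is outside, invariance of [n0] replaces [h] by [h + g]. Pulling back by
   [V j g] then removes [V j] from everything that depends on [g], and commutativity gathers the
   rest into [F i] along [V i g]. *)
have key n : inv_mean n -> n0 (fun h => n (fun g => E (fun y => d h y * d g y))) =
    n (fun g => fibre_expect n0 E (fun z => F0 z * \prod_(i <- s) F i (W i g z))).
  move=> [sn ni]; rewrite (mean_exchange st n0s sn Ad Ad dC dC).
  congr n; apply/funext => g.
  have bd : bfun (fun h => E (fun y => d h y * d g y)).
    have [c cP] := expectM_bfun st Ad dC (Ad g); exists c => h.
    rewrite [X in `|X|](_ : _ = E (fun y => d g y * d h y))//.
    by congr E; apply/funext => y; rewrite mulrC.
  rewrite -(n0i _ g bd); congr n0; apply/funext => h.
  rewrite -(act_expect aV j g (stateM st (Ad (h + g)) (Ad g))).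
  congr E; apply/funext => y; rewrite /d /F0 /F /W /= !actKV opprD (actD aV) actKV.
  rewrite big_split /=.
  have -> : \prod_(i <- s) f i (V i (h + g) (V j (- h) y)) =
      \prod_(i <- s) f i (V i h (V j (- h) (V i g y))).
    apply: eq_bigr => i _; rewrite (actD aV); do 2 congr (_ _).
    exact: (actC aV).
  ring.
have stF := fibre_state st n0s.
rewrite (key _ (conj sm im)) (key _ (conj sm' im')).
have bf0 := state_bfun st Af0; have bf i := state_bfun st (Af i).
have bcomp (Z : Type) (u : Y -> R) (t : Z -> Y) : bfun u -> bfun (fun z => u (t z)).
  by move=> [c cP]; exists c.
apply: (IH _ (@fibre_fun R G Y A) (fibre_expect n0 E) W F0 F) => //.
- exact: (@fibre_action R G Y A E n0 G I (fun=> V)).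
- split; first by apply: bfunM; exact: bcomp.
  by move=> h; apply: (stateM st) => //=; exact: (act_state aV).
- move=> i; split; first by apply: bfunM; exact: bcomp.
  move=> h; apply: (stateM st) => //=.
  exact: (act_state aV j (- h) (act_state aV i h (Af i))).
Qed.

(** Khintchine's inequality. The right side is the squared norm of the mean of the translates of
    [b], because all translates pair equally with that mean; its pairing with [1] is [E b], so its
    squared norm is at least [(E b)^2]. *)
Lemma mean_autocorrelation_ge (Y : Type) (A : set (Y -> R))
    (E : (Y -> R) -> R) (V : I -> G -> Y -> Y) (i : I) (b : Y -> R)
    (m : (G -> R) -> R) :
  is_state A E -> is_action A E V -> A b -> inv_mean m ->
  (E b) ^+ 2 <= m (fun g => E (fun y => b y * b (V i g y))).
Proof.
move=> st aV Ab [sm im].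
pose d g y := b (V i g y).
have Ad g : A (d g) by exact: (act_state aV).
have dC g : E (fun y => d g y * d g y) <= E (fun y => b y * b y).
  by rewrite -(act_expect aV i g (stateM st Ab Ab)).
set C := E _ in dC.
pose l w := m (fun g => E (fun y => w y * d g y)).
have ld h : l (d h) = l b.
  have bb := expectM_bfun st Ad dC (Ad h).
  rewrite /l -(im _ h bb); congr m; apply/funext => g.
  rewrite -[RHS](act_expect aV i h (stateM st Ab (Ad g))).
  by congr E; apply/funext => y; rewrite /d (actD aV).
have l1 : l (fun=> 1) = E b.
  rewrite /l -[RHS](expect_cst sm); congr m; apply/funext => g.
  rewrite -[RHS](act_expect aV i g Ab).
  by congr E; apply/funext => y; rewrite mul1r.
have half w : A w -> 2 * l w <= 2^-1 * E (fun y => w y * w y) + 2 * C.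
  move=> Aw; have h0 : (0 : R) < 2^-1 by rewrite invr_gt0.
  have := mean_expect_AGM st Ad dC sm h0 Aw; rewrite invrK -/(l w).
  have := ler_norm (l w); lra.
rewrite -/(l b); apply/ler_addgt0Pl => t t0.
have t30 : 0 < t / 3 by rewrite divr_gt0.
have [v [Av vB v_approx vmin]] := riesz_approx st (mean_expectD st Ad dC sm)
  (mean_expectZ st Ad dC sm) half (Num.max C (2 + 2 * (2 * C))) t30.
have bw : bfun (fun h => E (fun y => d h y * v y)).
  have [c cP] := expectM_bfun st Ad dC Av; exists c => h.
  by rewrite [X in `|X|](_ : _ = E (fun y => v y * d h y))//;
    congr E; apply/funext => y; rewrite mulrC.
have CB : C <= Num.max C (2 + 2 * (2 * C)) by rewrite le_max lexx.
have bl : bfun (fun h => l (d h)) by exists `|l b| => h; rewrite ld.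
have h1 := dist_mean_le sm bl bw (fun h => v_approx _ (Ad h) (le_trans (dC h) CB)).
have e1 : m (fun h => l (d h)) = l b.
  by rewrite -[RHS](expect_cst sm); congr m; apply/funext => h; rewrite ld.
have e2 : m (fun h => E (fun y => d h y * v y)) = l v.
  by congr m; apply/funext => h; congr E; apply/funext => y; rewrite mulrC.
have h2 : `|l v - E (fun y => v y * v y)| <= t / 3.
  by apply: v_approx => //; rewrite (le_trans vB)// le_max lexx orbT.
have A1 := state_cst st 1.
(* Comparing the minimiser with the constant [E b], where the quadratic expression equals
   [- (E b)^2], replaces Cauchy-Schwarz against [1]. *)
have := vmin _ (stateZ st (E b) A1).
rewrite (expect_sqrZ st)// mulr1 (expect1 st) mulr1.
rewrite (mean_expectZ st Ad dC sm (E b) A1) -/(l (fun=> 1)) l1 -/(l v).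
by move: h1 h2; rewrite e1 e2 !ler_norml; lra.
Qed.

End Correlations.

Lemma sqr_expect_le (R : realType) (Y : Type) (A : set (Y -> R)) (E : (Y -> R) -> R) f :
  is_state A E -> A f -> (E f) ^+ 2 <= E (fun y => f y ^+ 2).
Proof.
move=> st Af; have Ac := state_cst st (- E f).
have := expect_sqr_ge0 st (stateD st Af Ac).
rewrite (expect_sqrD st Af Ac) (expect_cst st).
have -> : E (fun y => f y * - E f) = - E f * E f.
  by rewrite -(expectZ st)//; congr E; apply/funext => y; rewrite mulrC.
have -> : E (fun y => f y ^+ 2) = E (fun y => f y * f y) by [].
rewrite expr2; lra.
Qed.

(** * Existence of invariant means *)

(** A linear functional below such a [q] is automatically positive, normalised and shift
    invariant. *)
Record upper_mean (R : realType) (G : zmodType) (q : (G -> R) -> R) : Prop := UpperMean {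
  umeanD : forall u v, bfun u -> bfun v -> q (fun g => u g + v g) <= q u + q v;
  umeanZ_le : forall t u, 0 <= t -> bfun u -> q (fun g => t * u g) <= t * q u;
  umean_le : forall u c, bfun u -> (forall g, u g <= c) -> q u <= c;
  umean_shift : forall u h, bfun u -> q (fun g => u (g + h) - u g) <= 0 }.

Section InvariantMeans.
Context (R : realType) (G : zmodType).
Implicit Types (u v x : G -> R) (q : (G -> R) -> R).

Lemma bfun_cst (Z : Type) c : bfun (fun _ : Z => c : R).
Proof. by exists `|c|. Qed.

Lemma bfunZ (Z : Type) c (f : Z -> R) : bfun f -> bfun (fun z => c * f z).
Proof. exact/bfunM/bfun_cst. Qed.

Lemma bfun_shift u h : bfun u -> bfun (fun g => u (g + h)).
Proof. by move=> [c cP]; exists c. Qed.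

Lemma umean0 q : upper_mean q -> q (fun=> 0) = 0.
Proof.
move=> uq; apply/eqP; rewrite eq_le (umean_le uq)//=; last exact: bfun_cst.
have := umeanD uq (bfun_cst G 0) (bfun_cst G 0); rewrite addr0; lra.
Qed.

Lemma umeanN_ge q u : upper_mean q -> bfun u -> - q u <= q (fun g => - 1 * u g).
Proof.
move=> uq bu; have := umeanD uq bu (bfunZ (-1) bu).
rewrite (_ : (fun g => u g + -1 * u g) = fun=> 0) ?umean0//; first lra.
by apply/funext => g; rewrite mulN1r subrr.
Qed.

Lemma umeanZ q t u : upper_mean q -> 0 <= t -> bfun u -> q (fun g => t * u g) = t * q u.
Proof.
move=> uq; rewrite le_eqVlt => /predU1P[<- bu|t0 bu].
  rewrite mul0r (_ : (fun g => 0 * u g) = fun=> 0) ?umean0//.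
  by apply/funext => g; rewrite mul0r.
apply/eqP; rewrite eq_le (umeanZ_le uq (ltW t0))//=.
have tV : 0 <= t^-1 by rewrite invr_ge0 ltW.
have := umeanZ_le uq tV (bfunZ t bu).
rewrite (_ : (fun g => t^-1 * (t * u g)) = u); first by rewrite mulrC ler_pdivlMr// mulrC.
by apply/funext => g; rewrite mulKf// gt_eqF.
Qed.

(** Common criterion for the three infima used below: tilts, infima of chains, and upper averages
    along a thick set. Each axiom has to be met only by suitable members of the sets [S u]. *)
Lemma upper_mean_inf (S : (G -> R) -> set R) :
  (forall u, bfun u -> has_lbound (S u)) ->
  (forall u v r s, bfun u -> bfun v -> S u r -> S v s ->
     exists2 t, S (fun g => u g + v g) t & t <= r + s) ->
  (forall c u r, 0 <= c -> bfun u -> S u r ->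
     exists2 t, S (fun g => c * u g) t & t <= c * r) ->
  (forall u c, bfun u -> (forall g, u g <= c) -> exists2 t, S u t & t <= c) ->
  (forall u h d, bfun u -> 0 < d ->
     exists2 t, S (fun g => u (g + h) - u g) t & t <= d) ->
  upper_mean (fun u => inf (S u)).
Proof.
move=> Slb SD SZ Sle Sshift.
have S0 u : bfun u -> S u !=set0.
  move=> bu; have [c cP] := bu.
  have [|t St _] := Sle u c bu; last by exists t.
  by move=> g; rewrite (le_trans (ler_norm _)).
split.
- move=> u v bu bv; rewrite -lerBlDr; apply: lb_le_inf; first exact: S0.
  move=> r Sr; rewrite lerBlDl -lerBlDr; apply: lb_le_inf; first exact: S0.
  move=> s Ss; have [t St tle] := SD _ _ _ _ bu bv Sr Ss.
  rewrite lerBlDl; apply: le_trans tle; apply: ge_inf St.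
  exact/Slb/bfunD.
- move=> c u c0 bu.
  have H r : S u r -> inf (S (fun g => c * u g)) <= c * r.
    move=> Sr; have [t St tle] := SZ _ _ _ c0 bu Sr; apply: le_trans tle.
    by apply: ge_inf St; exact/Slb/bfunZ.
  move: c0; rewrite le_eqVlt => /predU1P[c0|c0].
    have [r /H] := S0 _ bu; by rewrite -c0 !mul0r.
  rewrite -ler_pdivrMl//; apply: lb_le_inf; first exact: S0.
  by move=> r /H; rewrite ler_pdivrMl.
- move=> u c bu uc; have [t St tc] := Sle _ _ bu uc; apply: le_trans tc.
  by apply: ge_inf St; exact: Slb.
- move=> u h bu; apply/ler_addgt0Pl => d d0; rewrite addr0.
  have [t St tc] := Sshift _ h _ bu d0; apply: le_trans tc.
  apply: ge_inf St; apply: Slb; apply: bfunD; first exact: bfun_shift.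
  by have [c cP] := bu; exists c => g; rewrite normrN.
Qed.

(** The infimum of these values is the auxiliary functional of the Hahn-Banach argument: it lies
    below [q] and is at most [- q x] at [- x]. *)
Definition tilt q x u : set R := [set q (fun g => u g + t * x g) - t * q x | t in [set t | 0 <= t]].

Lemma tilt_lbound q x u : upper_mean q -> bfun x -> bfun u -> has_lbound (tilt q x u).
Proof.
move=> uq bx bu; exists (- q (fun g => - 1 * u g)) => _ [t /= t0 <-].
have := umeanD uq (bfunD bu (bfunZ t bx)) (bfunZ (-1) bu).
rewrite (_ : (fun g => u g + t * x g + -1 * u g) = fun g => t * x g).
  by rewrite (umeanZ uq t0 bx); lra.
by apply/funext => g; ring.
Qed.

Lemma tilt_sub q x u : bfun u -> tilt q x u (q u).
Proof.
move=> bu; exists 0; first by rewrite /=.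
by rewrite mul0r subr0; congr q; apply/funext => g; rewrite mul0r addr0.
Qed.

Lemma upper_mean_tilt q x : upper_mean q -> bfun x ->
  upper_mean (fun u => inf (tilt q x u)).
Proof.
move=> uq bx; apply: upper_mean_inf.
- by move=> u bu; exact: tilt_lbound.
- move=> u v _ _ bu bv [t /= t0 <-] [s /= s0 <-].
  exists (q (fun g => (u g + v g) + (t + s) * x g) - (t + s) * q x).
    by exists (t + s) => //=; rewrite addr_ge0.
  have := umeanD uq (bfunD bu (bfunZ t bx)) (bfunD bv (bfunZ s bx)).
  rewrite (_ : (fun g => u g + t * x g + (v g + s * x g)) =
    fun g => (u g + v g) + (t + s) * x g); first lra.
  by apply/funext => g; ring.
- move=> c u _ c0 bu [t /= t0 <-].
  exists (q (fun g => c * u g + (c * t) * x g) - (c * t) * q x).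
    by exists (c * t) => //=; rewrite mulr_ge0.
  have := umeanZ_le uq c0 (bfunD bu (bfunZ t bx)).
  rewrite (_ : (fun g => c * (u g + t * x g)) = fun g => c * u g + (c * t) * x g); first lra.
  by apply/funext => g; ring.
- by move=> u c bu uc; exists (q u); [exact: tilt_sub|exact: (umean_le uq)].
- move=> u h d bu d0; exists (q (fun g => u (g + h) - u g)).
    apply: tilt_sub; apply: bfunD; first exact: bfun_shift.
    by have [c cP] := bu; exists c => g; rewrite normrN.
  by rewrite (le_trans (umean_shift uq _ _))// ltW.
Qed.

(** Totality is what gives subadditivity: values at [u] and [v] coming from two members of the chain
    are both bounded below by those of the smaller member. *)
Lemma upper_mean_chain (T : set ((G -> R) -> R)) q0 : T q0 ->
  (forall q, T q -> upper_mean q) ->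
  (forall q q', T q -> T q' -> (forall u, bfun u -> q u <= q' u) \/
                               (forall u, bfun u -> q' u <= q u)) ->
  upper_mean (fun u => inf [set q u | q in T]) /\
  forall q u, T q -> bfun u -> inf [set q u | q in T] <= q u.
Proof.
move=> Tq0 TU Ttot.
have lb u : bfun u -> has_lbound [set q u | q in T].
  move=> bu; have [c cP] := bu; exists (- c) => _ [q Tq <-].
  have := umeanN_ge (TU q Tq) bu.
  have : q (fun g => -1 * u g) <= c.
    apply: (umean_le (TU q Tq)); first exact: bfunZ.
    by move=> g; rewrite mulN1r (le_trans (ler_norm _))// normrN.
  lra.
split; last by move=> q u Tq bu; apply: ge_inf; [exact: lb|exists q].
apply: upper_mean_inf => //.
- move=> u v _ _ bu bv [q Tq <-] [q' Tq' <-].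
  have [H|H] := Ttot _ _ Tq Tq'.
    exists (q (fun g => u g + v g)); first by exists q.
    by rewrite (le_trans (umeanD (TU q Tq) bu bv))// lerD2l H.
  exists (q' (fun g => u g + v g)); first by exists q'.
  by rewrite (le_trans (umeanD (TU q' Tq') bu bv))// lerD2r H.
- move=> c u _ c0 bu [q Tq <-]; exists (q (fun g => c * u g)); first by exists q.
  exact: (umeanZ_le (TU q Tq)).
- move=> u c bu uc; exists (q0 u); first by exists q0.
  exact: (umean_le (TU _ Tq0)).
- move=> u h d bu d0; exists (q0 (fun g => u (g + h) - u g)); first by exists q0.
  by rewrite (le_trans (umean_shift (TU _ Tq0) _ _))// ltW.
Qed.

(* The Hahn-Banach theorem: a minimal sublinear functional equals each of its
   tilts, which forces [q (- x) = - q x]. *)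
Lemma inv_mean_le_upper_mean q0 : upper_mean q0 ->
  exists m : (G -> R) -> R, inv_mean m /\ forall u, bfun u -> m u <= q0 u.
Proof.
move=> uq0.
pose T := {q : (G -> R) -> R | upper_mean q /\ forall u, bfun u -> q u <= q0 u}.
(* The order is reversed, so a maximal element for Zorn's lemma is a minimal functional; only values
   at bounded functions are compared. *)
pose leT (q q' : T) := `[< forall u, bfun u -> sval q' u <= sval q u >].
pose mkT q (uq : upper_mean q) (qq0 : forall u, bfun u -> q u <= q0 u) : T :=
  exist _ q (conj uq qq0).
pose t0 := mkT q0 uq0 (fun u _ => lexx (q0 u)).
have [|||[q [uq qq0]] qmin] := @ZL_preorder T t0 leT.
- by move=> t; apply/asboolP.
- move=> r s t /asboolP rs /asboolP st; apply/asboolP => u bu.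
  exact: le_trans (st _ bu) (rs _ bu).
- move=> B Btot; have [->|/set0P[b Bb]] := eqVneq B set0.
    by exists t0.
  pose TB := [set sval q | q in B].
  have TBb : TB (sval b) by exists b.
  have [||uI Ile] := @upper_mean_chain TB _ TBb.
  + by move=> _ [q _ <-]; exact: (svalP q).1.
  + move=> _ _ [q Bq <-] [q' Bq' <-].
    by have [/asboolP|/asboolP] := Btot _ _ Bq Bq'; [right|left].
  + have I0 u : bfun u -> inf [set q u | q in TB] <= q0 u.
      move=> bu; apply: le_trans (Ile _ _ TBb bu) _; exact: (svalP b).2.
    exists (mkT _ uI I0) => s Bs; apply/asboolP => u bu /=.
    by apply: Ile => //; exists s.
have qN x : bfun x -> q (fun g => - 1 * x g) = - q x.
  move=> bx; apply/eqP; rewrite eq_le umeanN_ge// andbT.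
  have ut := upper_mean_tilt uq bx.
  have tle u : bfun u -> inf (tilt q x u) <= q u.
    by move=> bu; apply: ge_inf; [exact: tilt_lbound|exact: tilt_sub].
  have tq0 u : bfun u -> inf (tilt q x u) <= q0 u.
    by move=> bu; apply: le_trans (tle _ bu) (qq0 _ bu).
  have bNx := bfunZ (-1) bx.
  have /asboolP/(_ _ bNx) /= := qmin (mkT _ ut tq0) (introT (asboolP _) tle).
  move=> /le_trans; apply; apply: ge_inf; first exact: tilt_lbound.
  (* At [t = 1] the tilt of [- x] along [x] has the value [q 0 - q x = - q x]. *)
  exists 1 => //=; rewrite (_ : (fun g => -1 * x g + 1 * x g) = fun=> 0) ?umean0//; first lra.
  by apply/funext => g; ring.
exists q; split=> //; split; first split=> //.
- exact: bfun_cst.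
- exact: bfunD.
- exact: bfunM.
- move=> u v bu bv; apply/eqP; rewrite eq_le (umeanD uq bu bv)/=.
  have := umeanD uq (bfunD bu bv) (bfunZ (-1) bv); rewrite qN//.
  rewrite (_ : (fun g => u g + v g + -1 * v g) = u); first lra.
  by apply/funext => g; ring.
- move=> c u bu; have [c0|c0] := leP 0 c; first exact: umeanZ.
  have c0' : 0 <= - c by lra.
  have := umeanZ uq c0' (bfunZ (-1) bu); rewrite qN// mulrNN => <-.
  by congr q; apply/funext => g; ring.
- move=> u bu u0; rewrite -oppr_le0 -qN//; apply: (umean_le uq); first exact: bfunZ.
  by move=> g; have := u0 g; lra.
- apply/eqP; rewrite eq_le; apply/andP; split.
    by apply: (umean_le uq) => //; exact: bfun_cst.
  rewrite -lerN2 -qN; last exact: bfun_cst.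
  by apply: (umean_le uq); [exact: bfun_cst|move=> g; rewrite mulr1].
- move=> u h bu.
  have shift_le v k : bfun v -> q (fun g => v (g + k)) <= q v.
    move=> bv; have bd : bfun (fun g => v (g + k) - v g).
      apply: bfunD; first exact: bfun_shift.
      by have [c cP] := bv; exists c => g; rewrite normrN.
    have := umeanD uq bd bv; have := umean_shift uq k bv.
    rewrite (_ : (fun g => v (g + k) - v g + v g) = fun g => v (g + k)); first lra.
    by apply/funext => g; ring.
  apply/eqP; rewrite eq_le shift_le//=.
  have := shift_le _ (- h) (bfun_shift h bu).
  by rewrite (_ : (fun g => u (g - h + h)) = u)//; apply/funext => g; rewrite subrK.
Qed.

(** Upper bounds for the averages of [u] over those translates of some finite [F] that lie in [B].
    For thick [B] their infimum is an upper Banach mean of [u] along [B]. *)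
Definition thick_upper_sums (B : set G) u : set R :=
  [set r | exists F : seq G, F <> [::] /\ forall g, (forall h, h \in F -> B (g + h)) ->
     \sum_(h <- F) u (g + h) <= r * (size F)%:R].

(** Thickness supplies a translate of [F] inside [B]; without one, [F] would admit every real
    number. *)
Lemma thick_upper_sums_lbound (B : set G) u :
  (forall F : seq G, exists g, forall h, h \in F -> B (g + h)) ->
  bfun u -> has_lbound (thick_upper_sums B u).
Proof.
move=> thB [b bP]; exists (- b) => r [F [F0 FP]].
have [g gP] := thB F; have sumF := FP g gP.
have sF : (0 : R) < (size F)%:R by case: F F0 {FP gP sumF} => // ? ? _; rewrite ltr0n.
rewrite -(ler_pM2r sF); apply: le_trans sumF.
have -> : - b * (size F)%:R = \sum_(h <- F) - b.
  by rewrite big_const_seq count_predT iter_addr_0 mulr_natr.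
by apply: ler_sum => h _; have := bP (g + h); rewrite ler_norml => /andP[].
Qed.

Lemma upper_mean_thick (B : set G) :
  (forall F : seq G, exists g, forall h, h \in F -> B (g + h)) ->
  upper_mean (fun u => inf (thick_upper_sums B u)).
Proof.
move=> thB; apply: upper_mean_inf.
- by move=> u bu; exact: thick_upper_sums_lbound.
- move=> u v r s bu bv [F [F0 FP]] [F' [F'0 F'P]].
  (* Averages over the sumset of [F] and [F'], counted with multiplicity, are averages over
     translates of [F] and also over translates of [F'], so both bounds apply. *)
  exists (r + s) => //; exists [seq h + h' | h <- F, h' <- F']; split.
    by case: F F0 {FP} => // a F _; case: F' F'0 {F'P} => // b F' _.
  move=> g gP; rewrite size_allpairs big_split/= mulrDl natrM; apply: lerD.
    rewrite big_allpairs_dep exchange_big/=.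
    apply: (@le_trans _ _ (\sum_(h' <- F') r * (size F)%:R)).
      rewrite !big_seq; apply: ler_sum => h' h'F.
      have := FP (g + h'); set X := \sum_(h <- F) _.
      rewrite (_ : \sum_(i <- F) u (g + (i + h')) = X); last first.
        by apply: eq_bigr => h _; rewrite -addrA (addrC h').
      apply=> h hF; rewrite -addrA (addrC h'); apply: gP.
      by apply/allpairsP; exists (h, h').
    rewrite big_const_seq count_predT iter_addr_0 -mulr_natr; lra.
  rewrite big_allpairs_dep/=.
  apply: (@le_trans _ _ (\sum_(h <- F) s * (size F')%:R)).
    rewrite !big_seq; apply: ler_sum => h hF.
    have := F'P (g + h); set X := \sum_(h <- F') _.
    rewrite (_ : \sum_(i <- F') v (g + (h + i)) = X); last first.
      by apply: eq_bigr => h' _; rewrite addrA.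
    apply=> h' h'F; rewrite -addrA; apply: gP.
    by apply/allpairsP; exists (h, h').
  rewrite big_const_seq count_predT iter_addr_0 -mulr_natr; lra.
- move=> c u r c0 bu [F [F0 FP]]; exists (c * r) => //; exists F; split => // g gP.
  by rewrite -mulr_sumr -mulrA ler_wpM2l// FP.
- move=> u c bu uc; exists c => //; exists [:: 0]; split => // g _.
  by rewrite big_seq1 mulr1.
- move=> u h d [c cP] d0; exists d => //.
  have c0 : 0 <= c by exact: le_trans (cP 0).
  (* Along the progression [0, h, ..., (N - 1) h] the sum telescopes to at most [2 * c], which this
     [N] makes smaller than [d * N]. Repetitions when [h] has finite order are harmless, [F] being a
     list. *)
  pose N := Num.bound (2 * c / d).
  have NP : 2 * c / d < N%:R by rewrite archi_boundP// divr_ge0// ?mulr_ge0// ltW.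
  exists [seq h *+ i | i <- iota 0 N]; split.
    move/(congr1 size); rewrite size_map size_iota => N0; move: NP; rewrite N0.
    by rewrite ltNge divr_ge0// ?mulr_ge0// ltW.
  move=> g _; rewrite size_map size_iota big_map.
  have -> : \sum_(i <- iota 0 N) (u (g + h *+ i + h) - u (g + h *+ i)) =
      u (g + h *+ N) - u g.
    have -> : iota 0 N = index_iota 0 N by rewrite /index_iota subn0.
    under eq_bigr do rewrite -addrA -mulrSr.
    by rewrite telescope_sumr// mulr0n addr0.
  have := cP (g + h *+ N); have := cP g; rewrite !ler_norml.
  move: NP; rewrite ltr_pdivrMr//; lra.
Qed.

Lemma exists_inv_mean : exists m : (G -> R) -> R, inv_mean m.
Proof.
have [|m [im _]] := inv_mean_le_upper_mean (@upper_mean_thick setT _).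
  by move=> F; exists 0.
by exists m.
Qed.

(** If the set where [f > c] is not syndetic, its complement is thick and carries an invariant mean
    whose value at [f] is at most [c]. *)
Lemma syndetic_of_means f (c : R) : bfun f ->
  (forall m : (G -> R) -> R, inv_mean m -> c < m f) ->
  exists F : seq G, forall g, exists2 h, h \in F & c < f (g + h).
Proof.
move=> bf mf; apply: contrapT => nF.
have thB (F : seq G) : exists g, forall h, h \in F -> f (g + h) <= c.
  apply: contrapT => nB; apply: nF; exists F => g.
  apply: contrapT => nh; apply: nB; exists g => h hF.
  by rewrite leNgt; apply/negP => ch; apply: nh; exists h.
have [m [im mle]] := inv_mean_le_upper_mean (@upper_mean_thick [set g | f g <= c] thB).
have := mf _ im; rewrite ltNge => /negP; apply.
apply: le_trans (mle _ bf) _; apply: ge_inf.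
  exact: thick_upper_sums_lbound.
(* For the one-point family [0] the average at [g] is [f g], bounded by [c] on the thick set. *)
exists [:: 0]; split => // g /(_ 0); rewrite inE eqxx => /(_ isT) /=.
by rewrite big_seq1 mulr1.
Qed.

End InvariantMeans.

(** * Probability spaces *)

Section MeasureState.
Context (d : measure_display) (X : measurableType d) (R : realType)
  (mu : probability X R).

Definition bmfun : set (X -> R) := [set f | measurable_fun setT f /\ bfun f].

Definition mean_value (f : X -> R) : R := \int[mu]_x f x.

Lemma bmfun_integrable f : bmfun f -> mu.-integrable setT (EFin \o f).
Proof.
move=> [mf [C fC]]; apply: measurable_bounded_integrable => //.
  by rewrite (le_lt_trans (probability_le1 mu measurableT))// ltry.
exists C; split; first exact: num_real.
by move=> x xC y _; exact: le_trans (fC y) (ltW xC).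
Qed.

Lemma mean_value_state : is_state bmfun mean_value.
Proof.
split.
- by move=> f [].
- by move=> c; split; [exact: measurable_cst|exists `|c|].
- move=> f g [mf bf] [mg bg]; split; last exact: bfunD.
  exact: measurable_realfun.measurable_funD.
- move=> f g [mf bf] [mg bg]; split; last exact: bfunM.
  exact: measurable_realfun.measurable_funM.
- by move=> f g Af Ag; rewrite /mean_value RintegralD//; exact: bmfun_integrable.
- by move=> c f Af; rewrite /mean_value RintegralZl//; exact: bmfun_integrable.
- by move=> f _ f0; exact: Rintegral_ge0.
- rewrite /mean_value Rintegral_cst// mul1r.
  exact: (congr1 fine (probability_setT mu)).
Qed.

Lemma mean_value_preserved (t : X -> X) f : measurable_fun setT t ->
  (forall B, measurable B -> mu (t @^-1` B) = mu B) -> bmfun f ->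
  mean_value (f \o t) = mean_value f.
Proof.
move=> mt tmu Af; have [mf [C fC]] := Af.
have Aft : bmfun (f \o t) by split; [exact: measurableT_comp|exists C => x; exact: fC].
rewrite /mean_value /Rintegral; congr fine.
have mEf := measurable_int mu (bmfun_integrable Af).
have := @integral_pushforward _ _ _ _ R _ mt mu setT (EFin \o f) mEf
  (bmfun_integrable Aft) measurableT.
rewrite preimage_setT => <-.
apply: eq_measure_integral => B mB _; exact: (tmu B mB).
Qed.

Lemma bmfun_indic (B : set X) : measurable B -> bmfun \1_B.
Proof.
move=> mB; split; first exact: measurable_realfun.measurable_indic.
by exists 1 => x; rewrite indicE; case: (x \in B); rewrite ?normr1 ?normr0.
Qed.

Lemma mean_value_indic (B : set X) : measurable B -> mean_value \1_B = fine (mu B).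
Proof. by move=> mB; rewrite /mean_value /Rintegral integral_indic// setIT. Qed.

End MeasureState.

(** * The group of k-tuples of endomorphisms *)

(** Closure of this predicate gives the tuples of endomorphisms a [zmodType] structure, over which
    invariant means are available. *)
Definition homk_pred (G : zmodType) (k : nat) : {pred 'I_k -> G -> G} :=
  fun phi => `[< homk_set phi >].

Lemma homk_zmod_closed (G : zmodType) (k : nat) : zmod_closed (@homk_pred G k).
Proof.
split; first by apply/asboolP => i x y; rewrite addr0.
move=> phi psi /asboolP hphi /asboolP hpsi; apply/asboolP => i x y.
by rewrite !fctE !(hphi, hpsi) opprD addrACA.
Qed.

HB.instance Definition _ (G : zmodType) (k : nat) :=
  GRing.isZmodClosed.Build _ (@homk_pred G k) (@homk_zmod_closed G k).

Record homk (G : zmodType) (k : nat) := HomK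
  { homk_val : 'I_k -> G -> G; _ : homk_val \in @homk_pred G k }.

Section HomkZmod.
Context (G : zmodType) (k : nat).
HB.instance Definition _ := [isSub for @homk_val G k].
HB.instance Definition _ := [Choice of homk G k by <:].
HB.instance Definition _ := [SubChoice_isSubZmodule of homk G k by <:].
End HomkZmod.

Lemma homkP (G : zmodType) (k : nat) (phi : homk G k) : homk_set (homk_val phi).
Proof. by case: phi => phi /= /asboolP. Qed.

Lemma homkD (G : zmodType) (k : nat) (phi psi : homk G k) i g :
  homk_val (phi + psi) i g = homk_val phi i g + homk_val psi i g.
Proof. by []. Qed.

Lemma homk0 (G : zmodType) (k : nat) i g : homk_val (0 : homk G k) i g = 0.
Proof. by []. Qed.

(** * Cubes *)

Section Cubes.
Context (k : nat).
Implicit Types (w : 'I_k -> bool) (i : 'I_k).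

Definition add_vertex (j : nat) w : 'I_k -> bool := fun i => (val i == j) || w i.

(** Vertices supported on the first [j] coordinates, listed as a face followed by its opposite face,
    so that a cube correlation becomes an autocorrelation at each stage. *)
Fixpoint cube (j : nat) : seq ('I_k -> bool) :=
  if j is j'.+1 then cube j' ++ [seq add_vertex j' w | w <- cube j']
  else [:: fun=> false].

Lemma cube_support j w i : w \in cube j -> (j <= i)%N -> w i = false.
Proof.
elim: j w => [|j IH] w /=; first by rewrite inE => /eqP ->.
rewrite mem_cat => /orP[wj|/mapP[v vj ->]] ji.
  by apply: IH => //; exact: ltnW.
by rewrite /add_vertex gtn_eqF// IH// ltnW.
Qed.

Lemma mem_cube j w : (forall i, (j <= i)%N -> w i = false) -> w \in cube j.
Proof.
elim: j w => [|j IH] w wj /=.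
  by rewrite inE; apply/eqP/funext => i; exact: wj.
rewrite mem_cat.
(* This is [w] with its coordinate [j] erased: the vertex of the smaller cube from which [w]
   arises. *)
have vj : (fun i => (val i != j) && w i) \in cube j.
  apply: IH => i; rewrite leq_eqVlt => /predU1P[->|ji]; first by rewrite eqxx.
  by rewrite wj// andbF.
have [[i [ij wi]]|nw] := pselect (exists i, val i = j /\ w i).
  apply/orP; right; apply/mapP; eexists; first exact: vj.
  apply/funext => i'; rewrite /add_vertex; have [e|] //= := eqVneq (val i') j.
  by rewrite (_ : i' = i)//; apply/val_inj; rewrite e ij.
apply/orP; left; rewrite (_ : w = fun i => (val i != j) && w i)//.
apply/funext => i; have [ij|//] := eqVneq (val i) j.
by apply/negP => wi; apply: nw; exists i.
Qed.

End Cubes.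

Section CubeSums.
Context (G : zmodType) (k : nat).
Implicit Types (phi : 'I_k -> G -> G) (w : 'I_k -> bool) (g : G).

Definition vertex_sum phi w g : G := \sum_(i < k) (phi i g *+ w i).

Lemma vertex_sumD phi w g h : homk_set phi ->
  vertex_sum phi w (g + h) = vertex_sum phi w g + vertex_sum phi w h.
Proof.
by move=> hphi; rewrite -big_split; apply: eq_bigr => i _; rewrite /= hphi mulrnDl.
Qed.

Lemma vertex_sum0 phi w : homk_set phi -> vertex_sum phi w 0 = 0.
Proof. by move=> hphi; apply: (addIr (vertex_sum phi w 0)); rewrite -vertex_sumD// !add0r. Qed.

Lemma vertex_sumDl (phi psi : homk G k) w g :
  vertex_sum (homk_val (phi + psi)) w g =
  vertex_sum (homk_val phi) w g + vertex_sum (homk_val psi) w g.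
Proof. by rewrite -big_split; apply: eq_bigr => i _; rewrite homkD mulrnDl. Qed.

Lemma vertex_sum_false phi g : vertex_sum phi (fun=> false) g = 0.
Proof. by rewrite /vertex_sum big1// => i _; rewrite mulr0n. Qed.

Lemma vertex_sum_add j phi w g : w \in cube k j ->
  vertex_sum phi (add_vertex j w) g =
  vertex_sum phi w g + vertex_sum phi (fun i => val i == j) g.
Proof.
move=> wj; rewrite -big_split; apply: eq_bigr => i _ /=.
rewrite -mulrnDr; congr (_ *+ _); rewrite /add_vertex.
have [ij|_] /= := eqVneq (val i) j; last by rewrite addn0.
by rewrite (cube_support wj) ?ij.
Qed.

Lemma homk_coord_subproof j (phi : homk G k) :
  (fun i g => if val i == j then homk_val phi i g else 0) \in @homk_pred G k.
Proof.
apply/asboolP => i x y; case: ifP => _; last by rewrite addr0.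
exact: homkP.
Qed.

(** The projection to one factor of [Hom(G,G)^k], used to average over a single coordinate. *)
Definition homk_coord j (phi : homk G k) : homk G k := HomK (homk_coord_subproof j phi).

Lemma vertex_sum_coord j (phi : homk G k) g :
  vertex_sum (homk_val (homk_coord j phi)) (fun i => val i == j) g =
  vertex_sum (homk_val phi) (fun i => val i == j) g.
Proof. by apply: eq_bigr => i _ /=; case: ifP => // _; rewrite !mulr0n. Qed.

Lemma vertex_sum_coord0 j (phi : homk G k) w g : w \in cube k j ->
  vertex_sum (homk_val (homk_coord j phi)) w g = 0.
Proof.
move=> wj; apply: big1 => i _ /=; case: ifP => [/eqP ij|_]; last by rewrite mul0rn.
by rewrite (cube_support wj) ?ij ?mulr0n.
Qed.

End CubeSums.

(** A shift of [u] becomes a shift in the outer variable [psi], so invariance holds whatever the map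
    [p]. With [p] a coordinate projection this isolates the average over that coordinate. *)
Lemma inv_mean_convolution (R : realType) (L : zmodType) (M : (L -> R) -> R)
    (p : L -> L) : inv_mean M ->
  inv_mean (fun u => M (fun psi => M (fun lam => u (psi + p lam)))).
Proof.
move=> [sM iM].
have bin (u : L -> R) psi : bfun u -> bfun (fun lam => u (psi + p lam)).
  by move=> [c cP]; exists c.
have bout (u : L -> R) : bfun u -> bfun (fun psi => M (fun lam => u (psi + p lam))).
  move=> bu; have [c cP] := bu; exists c => psi.
  by apply: (norm_expect_le sM); [exact: bin|move=> lam; exact: cP].
split; first split => //.
- exact: bfun_cst.
- exact: bfunD.
- exact: bfunM.
- move=> u v bu bv; rewrite -(expectD sM); [|exact: bout..].
  by congr M; apply/funext => psi; rewrite -(expectD sM)//; exact: bin.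
- move=> c u bu; rewrite -(expectZ sM); last exact: bout.
  by congr M; apply/funext => psi; rewrite -(expectZ sM)//; exact: bin.
- move=> u bu u0; apply: (expect_ge0 sM); first exact: bout.
  by move=> psi; apply: (expect_ge0 sM) => //; exact: bin.
- by rewrite (expect_cst sM) (expect1 sM).
- move=> u h bu; rewrite -[RHS](iM _ h (bout _ bu)).
  congr M; apply/funext => psi; congr M; apply/funext => lam.
  by rewrite addrAC.
Qed.

(** * Averages of cube correlations over tuples of endomorphisms *)

Section CubeAverages.
Context (G : zmodType) (d : measure_display) (X : measurableType d)
  (R : realType) (mu : probability X R) (T : G -> X -> X) (k : nat).
Hypothesis hT : mp_action mu T.

(** The actions commute because [G] is abelian. It serves with [L = G] for a fixed tuple, and with
    [L] the group of tuples evaluated at a fixed [g]. *)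
Lemma mp_action_is_action (L : zmodType) (I : Type) (r : I -> L -> G) :
  (forall i, r i 0 = 0) -> (forall i x y, r i (x + y) = r i x + r i y) ->
  is_action (@bmfun d X R) (mean_value mu) (fun i x => T (r i x)).
Proof.
have [T0 TD mT Tmu] := hT; move=> r0 rD; split.
- by move=> i y; rewrite r0 T0.
- by move=> i x y z; rewrite rD TD.
- move=> i j x y z; have := TD (r i x) (r j y); rewrite addrC TD.
  by move=> /(congr1 (fun t => t z))/esym.
- move=> i x f [mf [c cP]]; split; last by exists c.
  exact: measurableT_comp.
- move=> i x f bf; apply: (mean_value_preserved (mT _) _ bf) => B; exact: Tmu.
Qed.

Definition cube_fun (f : X -> R) j (phi : 'I_k -> G -> G) (z : G * X) : R :=
  \prod_(w <- cube k j) f (T (vertex_sum phi w z.1) z.2).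

Lemma cube_correlation_mean_unique f (phi : 'I_k -> G -> G) (m m' : (G -> R) -> R) :
  bmfun f -> homk_set phi -> inv_mean m -> inv_mean m' ->
  fibre_expect m (mean_value mu) (cube_fun f k phi) =
  fibre_expect m' (mean_value mu) (cube_fun f k phi).
Proof.
move=> bf hphi im im'; have st := mean_value_state mu.
have aV := @mp_action_is_action G _ (vertex_sum phi)
  (fun w => vertex_sum0 w hphi) (fun w x y => vertex_sumD w x y hphi).
have := @correlation_mean_unique R G _ (cube k k) _ _ _ _ (fun=> 1) (fun=> f) m m' st aV
  (state_cst st 1) (fun=> bf) im im'.
rewrite (_ : (fun g => _) = fun g => mean_value mu (fun x => cube_fun f k phi (g, x)))//.
by apply/funext => g; congr mean_value; apply/funext => x; rewrite mul1r.
Qed.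

Context (m : (G -> R) -> R) (f : X -> R).
Hypotheses (im : inv_mean m) (bf : bmfun f) (f_ge0 : forall x, 0 <= f x).

Let E' := fibre_expect m (mean_value mu).
Let A' := @fibre_fun R G X (@bmfun d X R).
Let V (w : 'I_k -> bool) (lam : homk G k) (z : G * X) :=
  (z.1, T (vertex_sum (homk_val lam) w z.1) z.2).

Let st' : is_state A' E'.
Proof. exact: fibre_state (mean_value_state mu) im.1. Qed.

Let aV : is_action A' E' V.
Proof.
apply: (@fibre_action R G X (@bmfun d X R) (mean_value mu) m (homk G k) _
  (fun g w lam => T (vertex_sum (homk_val lam) w g))) => g.
apply: (@mp_action_is_action _ _ (fun w lam => vertex_sum (homk_val lam) w g)).
  by move=> w; rewrite /vertex_sum big1// => i _; rewrite homk0 mul0rn.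
by move=> w x y; exact: vertex_sumDl.
Qed.

Let bf' : A' (fun z => f z.2).
Proof. by split; [case: bf => _ [c cP]; exists c|]. Qed.

Let cube_funE j lam :
  cube_fun f j (homk_val lam) = fun z => \prod_(w <- cube k j) f (V w lam z).2.
Proof. by []. Qed.

Let A'_cube j lam : A' (cube_fun f j (homk_val lam)).
Proof.
rewrite cube_funE; apply: (state_prod st') => w.
exact: (act_state aV w lam bf').
Qed.

Lemma cube_fun_bfun j : bfun (fun lam : homk G k => E' (cube_fun f j (homk_val lam))).
Proof.
have [C CP] := @prod_bounded R ('I_k -> bool) X (cube k j) (fun=> f) (fun=> bf.2).
by exists C => lam; apply: (norm_expect_le st') => // z; exact: CP.
Qed.

Lemma cube_fun_step j lam : cube_fun f j.+1 (homk_val lam) =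
  fun z => cube_fun f j (homk_val lam) z *
    cube_fun f j (homk_val lam) (V (fun i => val i == j) lam z).
Proof.
apply/funext => z; rewrite /cube_fun /= big_cat big_map /=; congr (_ * _).
apply: eq_big_seq => w wj; rewrite (vertex_sum_add _ _ wj).
by have [_ -> _ _] := hT.
Qed.

(** Each new coordinate doubles the exponent: Khintchine's inequality in that coordinate yields the
    square of the previous correlation, and the square passes outside the remaining mean by
    convexity. *)
Lemma cube_mean_ge j (M : (homk G k -> R) -> R) : inv_mean M ->
  (mean_value mu f) ^+ (2 ^ j) <=
  M (fun lam => E' (cube_fun f j (homk_val lam))).
Proof.
move=> iM; have [sM sh] := iM; have [T0 TD _ _] := hT.
have Ef0 : 0 <= mean_value mu f by exact: (expect_ge0 (mean_value_state mu)).
elim: j => [|j IH].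
  rewrite (_ : (fun lam => _) = fun=> mean_value mu f) ?(expect_cst sM) ?expr1//.
  apply/funext => lam; rewrite -[RHS](expect_cst im.1); congr m; apply/funext => g.
  congr mean_value; apply/funext => x.
  by rewrite /cube_fun big_seq1 vertex_sum_false T0.
pose F lam := E' (cube_fun f j.+1 (homk_val lam)).
pose M' u := M (fun psi => M (fun lam => u (psi + homk_coord j lam))).
(* The mean of a correlation is the same for all invariant means, so [M] may be replaced by one that
   averages over coordinate [j] first. *)
have -> : M F = M' F.
  have := @correlation_mean_unique R (homk G k) _ (cube k j.+1) _ A' E' V (fun=> 1)
    (fun=> fun z => f z.2) M M' st' aV (state_cst st' 1) (fun=> bf') iM
    (inv_mean_convolution _ iM).
  rewrite (_ : (fun lam => _) = F)//.
  by apply/funext => lam; congr E'; apply/funext => z; rewrite mul1r.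
pose b psi := cube_fun f j (homk_val psi).
(* The face [cube j] does not see coordinate [j], so [b psi] stays fixed during the inner
   average. *)
have bE psi lam : b (psi + homk_coord j lam) = b psi.
  apply/funext => z; apply: eq_big_seq => w wj.
  by rewrite vertex_sumDl vertex_sum_coord0// addr0.
have FE psi lam : F (psi + homk_coord j lam) =
    E' (fun z => b psi z * b psi (V (fun i => val i == j) (lam + psi) z)).
  rewrite /F cube_fun_step -/(b _) bE; congr E'; apply/funext => z.
  by rewrite /V !vertex_sumDl vertex_sum_coord addrC.
have bb psi : bfun (fun lam => E' (fun z => b psi z * b psi (V (fun i => val i == j) lam z))).
  apply: (expectM_bfun st' (C := E' (fun z => b psi z * b psi z))).
  - by move=> lam; apply: (act_state aV); exact: A'_cube.
  - move=> lam.
    by rewrite -[X in _ <= X](act_expect aV (fun i => val i == j) lam)//;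
      apply: (stateM st'); exact: A'_cube.
  - exact: A'_cube.
have inner psi : (E' (b psi)) ^+ 2 <= M (fun lam => F (psi + homk_coord j lam)).
  rewrite (funext (FE psi)) (sh _ psi (bb psi)).
  apply: (mean_autocorrelation_ge _ st' aV _ iM); exact: A'_cube.
have bEb : bfun (fun psi => E' (b psi)) by exact: cube_fun_bfun.
have bF : bfun F by exact: cube_fun_bfun.
have : M (fun psi => E' (b psi) ^+ 2) <= M' F.
  apply: (le_expect sM) => //; first exact: bfunM.
  have [c cP] := bF; exists c => psi.
  by apply: (norm_expect_le sM) => //; exists c.
apply: le_trans; apply: le_trans (sqr_expect_le sM bEb).
by rewrite expnSr exprM lerXn2r// nnegrE ?exprn_ge0// (le_trans _ IH)// exprn_ge0.
Qed.

End CubeAverages.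

(** * Return sets and the syndetic set of tuples *)

Lemma cube_fun_indic_le (G : zmodType) (d : measure_display) (X : measurableType d)
    (R : realType) (mu : probability X R) (T : G -> X -> X) (A : set X) (k : nat)
    (phi : 'I_k -> G -> G) (g : G) :
  mp_action mu T -> measurable A ->
  mean_value mu (fun x => cube_fun T (\1_A : X -> R) k phi (g, x)) <=
  fine (mu (\bigcap_(w in [set: 'I_k -> bool])
              (T (\sum_(i < k) (phi i g *+ w i)) @^-1` A))).
Proof.
move=> [_ _ mT _] mA; have st := mean_value_state mu.
have mTA (w : 'I_k -> bool) : measurable (T (vertex_sum phi w g) @^-1` A).
  by rewrite -[X in measurable X]setTI; exact: mT.
set B := \bigcap_(w in _) _.
have mB : measurable B.
  (* Indexing by the list [cube k k] exhibits the intersection as a finite one, hence measurable. *)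
  have -> : B = \bigcap_(w in [set` cube k k]) (T (vertex_sum phi w g) @^-1` A).
    apply/seteqP; split=> x Bx w _; first exact: Bx.
    apply: Bx; apply: mem_cube => i; by rewrite leqNgt ltn_ord.
  by apply: fin_bigcap_measurable => // w _; exact: mTA.
rewrite -mean_value_indic//; apply: (le_expect st).
- apply: (state_prod st) => w.
  rewrite [X in bmfun X](_ : _ = \1_(T (vertex_sum phi w g) @^-1` A))//.
  exact: bmfun_indic.
- exact: bmfun_indic.
move=> x; have [Bx|nBx] := pselect (B x).
  rewrite [leRHS]indicE mem_set//= /cube_fun; apply: prodr_ile1 => w _ /=.
  by rewrite indicE; case: (_ \in _); rewrite /= ?ler01 ?lexx.
have [w nw] : exists w, ~ A (T (vertex_sum phi w g) x).
  by apply/existsNP => H; apply: nBx => w _; exact: H.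
have wk : w \in cube k k by apply: mem_cube => i; rewrite leqNgt ltn_ord.
rewrite (_ : cube_fun _ _ _ _ _ = 0) ?indicE ?ler0n//; apply/eqP.
rewrite prodf_seq_eq0; apply/hasP; exists w => //=.
by rewrite indicE memNset.
Qed.


Theorem theorem13p3 (G : countZmodType) (d : measure_display)
  (X : measurableType d) (R : realType) (mu : probability X R)
  (T : G -> X -> X) (hT : mp_action mu T)
  (A : set X) (mA : measurable A) (k : nat) (eps : R) (heps : 0 < eps) :
  exists S : set ('I_k -> G -> G),
    syndetic_homk S /\
    forall phi, S phi -> syndetic_discrete (Rset mu T A eps phi).
Proof.
have [m im] := exists_inv_mean R G.
pose f : X -> R := \1_A; have bf : bmfun f by exact: bmfun_indic.
have f0 x : 0 <= f x by rewrite /f indicE ler0n.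
pose c := fine (mu A) ^+ (2 ^ k) - eps.
pose u (phi : 'I_k -> G -> G) := fibre_expect m (mean_value mu) (cube_fun T f k phi).
exists [set phi | homk_set phi /\ c < u phi]; split.
  split; first by move=> phi [].
  have [||F FP] := @syndetic_of_means R (homk G k) (fun lam => u (homk_val lam)) c.
  - exact: cube_fun_bfun.
  - move=> M iM; apply: lt_le_trans (cube_mean_ge hT im bf f0 k iM).
    by rewrite mean_value_indic// /c ltrBlDr ltrDl.
  (* Finitely many translations suffice: [psi = (psi + h) + (- h)] with [psi + h] in the set. *)
  exists [set homk_val (- h) | h in [set` F]]; split.
    by apply: finite_compact; apply: finite_image; exact: finite_seq.
  split; first by move=> _ [h _ <-]; exact: homkP.
  move=> psi hpsi; have psiP : psi \in @homk_pred G k by exact/asboolP.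
  have [h hF ch] := FP (HomK psiP).
  exists (homk_val (HomK psiP + h)); first by split => //; exact: homkP.
  exists (homk_val (- h)); first by exists h.
  apply/funext => i; apply/funext => g.
  by rewrite -homkD addrK.
move=> phi [hphi cphi].
have bu : bfun (fun g => mean_value mu (fun x => cube_fun T f k phi (g, x))).
  have [C CP] := @prod_bounded R _ X (cube k k) (fun=> f) (fun=> bf.2).
  have st := mean_value_state mu; exists C => g.
  apply: (norm_expect_le st); last by move=> x; exact: CP.
  apply: (state_prod st) => w; have [_ _ mT _] := hT.
  split; last by have [b bP] := bf.2; exists b.
  exact: (measurableT_comp bf.1 (mT (vertex_sum phi w g))).
(* The bound known for the fixed mean [m] transfers to any [m'] by uniqueness of the averaged
   correlation. *)
have [m' im'|F FP] := syndetic_of_means bu (c := c).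
  by rewrite -/(fibre_expect m' _ _) -(cube_correlation_mean_unique hT bf hphi im im').
(* The signs change because [syndetic_discrete] subtracts the translating element. *)
exists [seq - h | h <- F] => g; have [h hF ch] := FP g.
exists (- h); first exact: map_f.
by rewrite /Rset /= opprK; exact: lt_le_trans ch (cube_fun_indic_le _ _ hT mA).
Qed.
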